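(* Let $n\ge 2$ and $\theta\in(0,2\pi)$, and consider the (admissible) geodesic billiard trajectories on the lune $\mathbb{L}^n_\theta$. (i) If $\theta$ is a rational multiple of $\pi$, then all geodesic billiard trajectories on $\mathbb{L}^n_\theta$ are periodic. If $\theta=m\pi/p$ with $m,p\in\mathbb{N}$ relatively prime, all these orbits have minimal period $2p$, except for the single trajectory which is orthogonal to all meridians (the one defined by the equatorial geodesic $\gamma_e(t)=(0,\cos t,\sin t)$, $0\in\mathbb{R}^{n-1}$), which has period two. (ii) If $\theta$ is not a rational multiple of $\pi$, there are no periodic orbits except for the single $2$-periodic orbit which is orthogonal to all meridians.
   Context: Write $\mathbb{R}^{n+1}=\mathbb{R}^{n-1}\times\mathbb{R}^2$ and let $\mathbb{S}^n\subset\mathbb{R}^{n+1}$ be the unit sphere with its canonical metric. For $\phi\in\mathbb{R}$ the meridian of angle $\phi$ is $\partial_\phi=\{(w,r\cos\phi,r\sin\phi): w\in\mathbb{R}^{n-1}, |w|\le 1, r=\sqrt{1-|w|^2}\}$. The lune of opening angle $\theta$ is $\mathbb{L}^n_\theta=\bigcup_{\alpha\in[0,\theta]}\partial_\alpha\subset\mathbb{S}^n$; its boundary is $\partial_0\cup\partial_\theta$. The polar sphere is $\mathbb{S}^n\cap(\mathbb{R}^{n-1}\times\{(0,0)\})$, the common intersection of all meridians. Billiard trajectories: without loss of generality a trajectory $T(t)$ starts at time $t_0$ at a boundary point of $\partial_0$, and is defined by an initial unit-speed geodesic $\gamma$ of $\mathbb{S}^n$ with $\gamma(t_0)\in\partial_0$.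 It is admissible if $\gamma$ points to the interior of the lune at $t_0$ and $\gamma$ does not intersect the polar sphere; only admissible trajectories are considered. $T$ follows $\gamma$ until the next time at which it hits the boundary, where its velocity is reflected in the hyperplane supporting the boundary meridian that is hit (angle of incidence equals angle of reflection), and it continues along the geodesic with the reflected velocity, and so on. Let $t_0<t_1<t_2<\cdots$ be the successive boundary collision times. $T$ is periodic of period $q\in\mathbb{N}$ if it closes up after $q$ geodesic segments: $T(t_q)=T(t_0)$ and the last and the initial geodesic segments satisfy the reflection law at that point (the reflection of $T'(t_q^-)$ is $T'(t_0^+)$). *)

(* Defs.v *)
(* MathComp / MathComp-Analysis *)
From HB Require Import structures.
From mathcomp Require Import all_boot all_order all_algebra.
From mathcomp Require Import all_classical all_reals all_analysis.

Set Implicit Arguments.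
Unset Strict Implicit.
Unset Printing Implicit Defensive.

Import Order.TTheory GRing.Theory Num.Theory.
Import numFieldNormedType.Exports.

Local Open Scope classical_set_scope.
Local Open Scope ring_scope.

(* The library norm on row vectors is the sup norm, so the Euclidean structure
   is introduced separately.  Derivatives do not depend on this choice. *)
Definition dot (R : realType) (k : nat) (u v : 'rV[R]_k) : R :=
  \sum_(i < k) u 0 i * v 0 i.

Definition enorm (R : realType) (k : nat) (u : 'rV[R]_k) : R :=
  Num.sqrt (dot u u).

(* R^(n+1) = R^(n-1) x R^2, meant for 1 <= n. *)
Notation ambient R n := 'rV[R]_(n.-1 + 2).

Definition pt (R : realType) (n : nat) (w : 'rV[R]_n.-1) (x y : R) :
    ambient R n :=
  row_mx w (\row_(j < 2) if j == 0 then x else y).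

Definition sphere (R : realType) (n : nat) : set (ambient R n) :=
  [set x | enorm x = 1].

Definition meridian (R : realType) (n : nat) (phi : R) : set (ambient R n) :=
  [set x | exists w : 'rV[R]_n.-1, enorm w <= 1 /\
     let r := Num.sqrt (1 - enorm w ^+ 2) in
     x = pt w (r * cos phi) (r * sin phi)].

Definition lune (R : realType) (n : nat) (theta : R) : set (ambient R n) :=
  \bigcup_(alpha in [set a | 0 <= a <= theta]) @meridian R n alpha.

Definition lune_boundary (R : realType) (n : nat) (theta : R) :
    set (ambient R n) :=
  @meridian R n 0 `|` @meridian R n theta.

Definition lune_interior (R : realType) (n : nat) (theta : R) :
    set (ambient R n) :=
  @lune R n theta `\` @lune_boundary R n theta.

Definition polar_sphere (R : realType) (n : nat) : set (ambient R n) :=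
  @sphere R n `&` [set x | exists w : 'rV[R]_n.-1, x = pt w 0 0].

(* The covariant derivative of the velocity of a curve in the sphere is the
   tangential part of its acceleration; for a geodesic it vanishes, i.e. the
   acceleration is orthogonal to the tangent space of the sphere. *)
Definition unit_speed_geodesic (R : realType) (n : nat)
    (g : R -> ambient R n) : Prop :=
  [/\ forall s, @sphere R n (g s),
      forall s, derivable g s 1,
      forall s, derivable (derive1 g) s 1,
      forall s, enorm (derive1 g s) = 1
    & forall s (u : ambient R n),
        dot u (g s) = 0 -> dot u (derive1 (derive1 g) s) = 0].

(* Unit normal of the linear hyperplane containing the meridian of angle phi. *)
Definition meridian_normal (R : realType) (n : nat) (phi : R) : ambient R n :=
  pt 0 (- sin phi) (cos phi).

Definition reflection (R : realType) (n : nat) (phi : R) (v : ambient R n) :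
    ambient R n :=
  v - (2 * dot v (meridian_normal n phi)) *: meridian_normal n phi.

(* At the boundary point x, the incoming velocity v is reflected to v'.
   Outside the polar sphere (and for 0 < theta < 2 pi) only one of the two
   boundary meridians contains x. *)
Definition reflects (R : realType) (n : nat) (theta : R)
    (x v v' : ambient R n) : Prop :=
  exists phi : R, [/\ phi = 0 \/ phi = theta,
    @meridian R n phi x & v' = reflection phi v].

Definition admissible (R : realType) (n : nat) (theta t0 : R)
    (g : R -> ambient R n) : Prop :=
  [/\ unit_speed_geodesic g,
      @meridian R n 0 (g t0),
      \forall s \near t0^'+, @lune_interior R n theta (g s)
    & forall s, ~ @polar_sphere R n (g s)].

(* t i is the i-th collision time (t 0 being the starting time), and g i is the
   complete geodesic that the trajectory follows on [t i, t (i + 1)]. *)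
Definition billiard_trajectory (R : realType) (n : nat) (theta : R)
    (t : nat -> R) (g : nat -> R -> ambient R n) : Prop :=
  admissible theta (t 0%N) (g 0%N) /\
  forall i : nat,
    [/\ t i < t i.+1,
        @lune_boundary R n theta (g i (t i.+1))
      & forall s, t i < s < t i.+1 -> ~ @lune_boundary R n theta (g i s)] /\
    [/\ unit_speed_geodesic (g i.+1),
        g i.+1 (t i.+1) = g i (t i.+1)
      & reflects theta (g i (t i.+1))
          (derive1 (g i) (t i.+1)) (derive1 (g i.+1) (t i.+1))].

Definition has_period (R : realType) (n : nat) (theta : R)
    (t : nat -> R) (g : nat -> R -> ambient R n) (q : nat) : Prop :=
  [/\ (0 < q)%N,
      g q.-1 (t q) = g 0%N (t 0%N)
    & reflects theta (g 0%N (t 0%N))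
        (derive1 (g q.-1) (t q)) (derive1 (g 0%N) (t 0%N))].

Definition periodic_trajectory (R : realType) (n : nat) (theta : R)
    (t : nat -> R) (g : nat -> R -> ambient R n) : Prop :=
  exists q : nat, has_period theta t g q.

Definition has_minimal_period (R : realType) (n : nat) (theta : R)
    (t : nat -> R) (g : nat -> R -> ambient R n) (q : nat) : Prop :=
  has_period theta t g q /\
  forall k : nat, has_period theta t g k -> (q <= k)%N.

(* Tangent space of the meridian of angle phi at a point x outside the polar
   sphere. *)
Definition meridian_tangent (R : realType) (n : nat) (phi : R)
    (x : ambient R n) : set (ambient R n) :=
  [set u | dot u x = 0 /\ dot u (meridian_normal n phi) = 0].

Definition orthogonal_to_meridians (R : realType) (n : nat)
    (t : nat -> R) (g : nat -> R -> ambient R n) : Prop :=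
  forall (i : nat) (s phi : R), t i <= s <= t i.+1 ->
    @meridian R n phi (g i s) ->
    forall u, meridian_tangent phi (g i s) u -> dot u (derive1 (g i) s) = 0.

Definition equator (R : realType) (n : nat) (s : R) : ambient R n :=
  pt 0 (cos s) (sin s).

(* Up to the choice of the starting time, exactly one trajectory is orthogonal
   to all meridians; it is the one started by the equator, and it has (minimal)
   period two. *)
Definition single_orthogonal_orbit (R : realType) (n : nat) (theta : R) :
    Prop :=
  (exists (t : nat -> R) (g : nat -> R -> ambient R n),
     [/\ billiard_trajectory theta t g, t 0%N = 0 & g 0%N = @equator R n]) /\
  forall (t : nat -> R) (g : nat -> R -> ambient R n),
    billiard_trajectory theta t g ->
    (orthogonal_to_meridians t g <->
       g 0%N = (fun s => @equator R n (s - t 0%N))) /\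
    (orthogonal_to_meridians t g -> has_minimal_period theta t g 2).

(* Main.v *)
Require Import Defs.
From HB Require Import structures.
From mathcomp Require Import all_boot all_order all_algebra.
From mathcomp Require Import all_classical all_reals all_analysis.
From mathcomp Require Import ring lra.

Set Implicit Arguments.
Unset Strict Implicit.
Unset Printing Implicit Defensive.

Import Order.TTheory GRing.Theory Num.Theory.
Import numFieldNormedType.Exports.

Local Open Scope classical_set_scope.
Local Open Scope ring_scope.

(* Geodesics of the sphere are great circles (g'' = - g), and a great circle
   avoiding the polar sphere projects to R^2 as a curve cos s * a + sin s * b
   with det(a, b) <> 0.  Such a curve returns to a given half-line only after
   time 2 pi and meets every half-line in between, so a trajectory alternates
   between the two walls, and its i-th geodesic is the initial one composed with
   alternating reflections in the meridians of angle theta and 0.  An even number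
   2 j of them is the rotation of angle - 2 j theta of the plane factor.  A closed
   trajectory has even period 2 j; if its R^(n-1) component w is not identically
   zero, w forces the elapsed time into 2 pi Z, hence 2 j theta into 2 pi Z.
   Conversely, if 2 j theta is in 2 pi Z, the 2 j-th geodesic is the initial one,
   and both collision points lie on the half-line of angle 0, hence coincide.
   Orthogonality to the meridians means w = 0, which leaves only the equator. *)

(** * Trigonometry: angles modulo 2 pi and polar coordinates *)

Lemma periodicz (R : realType) (f : R -> R) (T : R) : periodic f T ->
  forall (k : int) (x : R), f (x + k%:~R * T) = f x.
Proof.
move=> fT [n|n] x.
  by rewrite -pmulrn mulr_natl (periodicn fT).
by rewrite NegzE rmorphN/= -pmulrn mulNr mulr_natl -[LHS](periodicn fT n.+1) subrK.
Qed.

Lemma cosD2piz (R : realType) (x : R) (k : int) :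
  cos (x + k%:~R * (2 * pi)) = cos x.
Proof. by rewrite mulr_natl (periodicz (@cosD2pi R)). Qed.

Lemma sinD2piz (R : realType) (x : R) (k : int) :
  sin (x + k%:~R * (2 * pi)) = sin x.
Proof. by rewrite mulr_natl (periodicz (@sinD2pi R)). Qed.

(** Half-angle formula: cos x = 1 - 2 sin^2 (x / 2), and x / 2 lies in (0, pi), where the sine is
    positive. *)
Lemma cos_lt1 (R : realType) (x : R) : 0 < x < 2 * pi -> cos x < 1.
Proof.
move=> /andP[x0 x2]; have -> : x = (x / 2) *+ 2 by rewrite -mulr_natr divfK.
have : 0 < sin (x / 2) by apply: sin_gt0_pi; apply/andP; split; lra.
by rewrite cos_mulr2n cos2sin2 mulr2n => s0; nra.
Qed.

Lemma cos_eq1 (R : realType) (x : R) :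
  cos x = 1 -> exists k : int, x = k%:~R * (2 * pi).
Proof.
move=> cx; have pi0 := @pi_gt0 R.
exists (Num.floor (x / (2 * pi))).
set k := Num.floor _; pose y := x + (- k)%:~R * (2 * pi).
have /andP[y0 y2] : 0 <= y < 2 * pi.
  have /andP[] := floor_itv (x / (2 * pi)).
  rewrite -/k ler_pdivlMr ?ltr_pdivrMr ?mulr_gt0// intrD => h1 h2.
  by rewrite /y rmorphN/=; apply/andP; split; lra.
have cy : cos y = 1 by rewrite cosD2piz.
move: y0; rewrite le_eqVlt => /predU1P[y0|y0].
  by move: y0; rewrite /y rmorphN/=; lra.
by have := @cos_lt1 _ y; rewrite y0 y2 cy ltxx => /(_ isT).
Qed.

(** Equal cosines and sines make cos (x - y) = 1, which [cos_lt1] excludes for 0 < |x - y| < 2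
    pi. *)
Lemma cos_sin_inj (R : realType) (x y : R) : `|x - y| < 2 * pi ->
  cos x = cos y -> sin x = sin y -> x = y.
Proof.
move=> xy cxy sxy; apply/eqP; rewrite -subr_eq0 -normr_eq0.
apply: contraTT isT => xy0.
have := @cos_lt1 _ `|x - y|; rewrite xy normr_gt0 -normr_eq0 xy0 => /(_ isT).
by rewrite cos_norm cosB cxy sxy -!expr2 cos2Dsin2 ltxx.
Qed.

Lemma cos_sin_surj (R : realType) (x y : R) : x ^+ 2 + y ^+ 2 = 1 ->
  exists2 s, 0 <= s < 2 * pi & cos s = x /\ sin s = y.
Proof.
move=> xy1; have pi0 := @pi_gt0 R.
have xb : -1 <= x <= 1 by apply/andP; split; nra.
have sE : sin (acos x) = `|y|.
  by rewrite sin_acos// -xy1 addrC addKr sqrtr_sqr.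
have x0 := acos_ge0 xb; have xpi := acos_lepi xb.
have [y0|y0] := leP 0 y.
  exists (acos x); first by apply/andP; split=> //; lra.
  by rewrite acosK// sE ger0_norm.
exists (- acos x + pi *+ 2).
  (* A zero arc cosine would put the chosen angle at 2 pi, outside the half-open interval; it is
     excluded because it would force y = 0. *)
  have : acos x != 0.
    apply: contraTN y0 => /eqP a0; move: sE.
    by rewrite a0 sin0 => /esym/normr0_eq0 ->; rewrite ltxx.
  rewrite neq_lt ltNge x0 /= => a0; apply/andP; split; rewrite ?mulr2n; lra.
by rewrite cosD2pi sinD2pi cosN sinN acosK// sE ltr0_norm// opprK.
Qed.

(** * Bilinearity and definiteness of the Euclidean product *)

Lemma dotC (R : realType) (k : nat) (u v : 'rV[R]_k) : dot u v = dot v u.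
Proof. by apply: eq_bigr => i _; rewrite mulrC. Qed.

Lemma dotDl (R : realType) (k : nat) (u v x : 'rV[R]_k) :
  dot (u + v) x = dot u x + dot v x.
Proof. by rewrite -big_split; apply: eq_bigr => i _; rewrite mxE mulrDl. Qed.

Lemma dotZl (R : realType) (k : nat) (c : R) (u x : 'rV[R]_k) :
  dot (c *: u) x = c * dot u x.
Proof. by rewrite mulr_sumr; apply: eq_bigr => i _; rewrite mxE mulrA. Qed.

Lemma dotDr (R : realType) (k : nat) (u v x : 'rV[R]_k) :
  dot x (u + v) = dot x u + dot x v.
Proof. by rewrite !(dotC x) dotDl. Qed.

Lemma dotZr (R : realType) (k : nat) (c : R) (u x : 'rV[R]_k) :
  dot x (c *: u) = c * dot x u.
Proof. by rewrite !(dotC x) dotZl. Qed.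

Lemma dotNl (R : realType) (k : nat) (u x : 'rV[R]_k) :
  dot (- u) x = - dot u x.
Proof. by rewrite -scaleN1r dotZl mulN1r. Qed.

Lemma dotNr (R : realType) (k : nat) (u x : 'rV[R]_k) :
  dot x (- u) = - dot x u.
Proof. by rewrite dotC dotNl dotC. Qed.

Definition dotE := (dotDl, dotDr, dotZl, dotZr, dotNl, dotNr).

Lemma dot0l (R : realType) (k : nat) (x : 'rV[R]_k) : dot 0 x = 0.
Proof. by rewrite -(scale0r 0) dotZl mul0r. Qed.

Lemma dot_ge0 (R : realType) (k : nat) (u : 'rV[R]_k) : 0 <= dot u u.
Proof. by apply: sumr_ge0 => i _; rewrite -expr2 sqr_ge0. Qed.

Lemma dot_eq0 (R : realType) (k : nat) (u : 'rV[R]_k) : dot u u = 0 -> u = 0.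
Proof.
move=> /eqP; rewrite psumr_eq0 => [/allP u0|i _]; last by rewrite -expr2 sqr_ge0.
apply/rowP => i; have := u0 i (mem_index_enum i).
by rewrite -expr2 sqrf_eq0 mxE => /eqP.
Qed.

Lemma enorm_sqr (R : realType) (k : nat) (u : 'rV[R]_k) : enorm u ^+ 2 = dot u u.
Proof. by rewrite sqr_sqrtr// dot_ge0. Qed.

Lemma enorm_eq1 (R : realType) (k : nat) (u : 'rV[R]_k) : enorm u = 1 <-> dot u u = 1.
Proof.
by split=> [u1|u1]; [rewrite -enorm_sqr u1 expr1n|rewrite /enorm u1 sqrtr1].
Qed.

(** * Derivatives of vector-valued curves, coordinate by coordinate *)

Lemma is_derive_coord (R : realType) (k : nat) (f : R -> 'rV[R]_k) (s : R) (i : 'I_k) :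
  derivable f s 1 -> is_derive s (1 : R) (fun s => f s 0 i) (derive1 f s 0 i).
Proof.
move=> df; have /derivable_mxP/(_ 0 i) dfi := df.
by apply: DeriveDef => //; rewrite derive1E derive_mx// mxE.
Qed.

Lemma is_derive_row (R : realType) (k : nat) (f : R -> 'rV[R]_k) (s : R) (df : 'rV[R]_k) :
  (forall i, is_derive s (1 : R) (fun s => f s 0 i) (df 0 i)) -> is_derive s (1 : R) f df.
Proof.
move=> dfi; have df' : derivable f s 1.
  by apply/derivable_mxP => i j; rewrite ord1; have [] := dfi j.
apply: DeriveDef => //; rewrite derive_mx//; apply/rowP => j; rewrite mxE.
by have [] := dfi j.
Qed.

Lemma is_derive_dot (R : realType) (k : nat) (f g : R -> 'rV[R]_k) (s : R) :
  derivable f s 1 -> derivable g s 1 ->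
  is_derive s (1 : R) (fun s => dot (f s) (g s)) (dot (derive1 f s) (g s) + dot (f s) (derive1 g s)).
Proof.
move=> df dg.
have -> : (fun s => dot (f s) (g s)) =
    \sum_(i < k) ((fun s => f s 0 i) * (fun s => g s 0 i)).
  by apply/funext => x; rewrite fct_sumE.
have dfi i := is_derive_coord i df; have dgi i := is_derive_coord i dg.
apply: is_derive_eq; rewrite -big_split; apply: eq_bigr => i _ /=.
by rewrite addrC; congr (_ + _); exact: mulrC.
Qed.

Lemma scaleR_mul (R : realType) (x y : R) : x *: (y : R^o) = x * y.
Proof. by []. Qed.

(** * Great circles and their identification with the unit-speed geodesics *)

Definition great_circle (R : realType) (k : nat) (a b : 'rV[R]_k) (t s : R) :
    'rV[R]_k :=
  cos (s - t) *: a + sin (s - t) *: b.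

Lemma is_derive_great_circle (R : realType) (k : nat) (a b : 'rV[R]_k) (t s : R) :
  is_derive s (1 : R) (great_circle a b t) (great_circle b (- a) t s).
Proof.
apply: is_derive_row => i.
have -> : (fun s => great_circle a b t s 0 i) =
    (cos t * a 0 i - sin t * b 0 i) \*: (@cos R)
    + (sin t * a 0 i + cos t * b 0 i) \*: (@sin R).
  apply/funext => x; rewrite !mxE cosB sinB !fctE /= !scaleR_mul; ring.
apply: is_derive_eq; rewrite !mxE cosB sinB !scaleR_mul; ring.
Qed.

Lemma derive1_great_circle (R : realType) (k : nat) (a b : 'rV[R]_k) (t : R) :
  derive1 (great_circle a b t) = great_circle b (- a) t.
Proof.
by apply/funext => s; rewrite derive1E; have [_] := is_derive_great_circle a b t s.
Qed.

Lemma dot_great_circle (R : realType) (k : nat) (a b : 'rV[R]_k) (t s : R) :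
  dot a a = 1 -> dot b b = 1 -> dot a b = 0 ->
  dot (great_circle a b t s) (great_circle a b t s) = 1.
Proof.
move=> aa bb ab; rewrite !dotE (dotC b a) aa bb ab -[RHS](cos2Dsin2 (s - t)); ring.
Qed.

Lemma unit_speed_geodesic_great_circle (R : realType) (n : nat)
    (a b : ambient R n) (t : R) :
  dot a a = 1 -> dot b b = 1 -> dot a b = 0 ->
  unit_speed_geodesic (great_circle a b t).
Proof.
move=> aa bb ab; have dgc (a' b' : ambient R n) s : derivable (great_circle a' b' t) s 1.
  by have [] := is_derive_great_circle a' b' t s.
rewrite /unit_speed_geodesic !derive1_great_circle; split => //.
- by move=> s; apply/enorm_eq1/dot_great_circle.
- by move=> s; apply/enorm_eq1/dot_great_circle; rewrite ?dotE ?opprK// dotC ab oppr0.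
- by move=> s u; rewrite !dotE => us; rewrite !mulrN -opprD us oppr0.
Qed.

(** Differentiating <g, g> = 1 and then <g, g'> = 0 fixes the normal part of the acceleration, and
    its tangential part vanishes; hence g'' = - g, which is solved from the data at an arbitrary
    base time [t]. *)
Lemma unit_speed_geodesicP (R : realType) (n : nat) (g : R -> ambient R n) (t : R) :
  unit_speed_geodesic g ->
  [/\ dot (g t) (g t) = 1, dot (derive1 g t) (derive1 g t) = 1,
    dot (g t) (derive1 g t) = 0
  & g = great_circle (g t) (derive1 g t) t].
Proof.
case=> g1 dg ddg dg1 geo.
have {}g1 s : dot (g s) (g s) = 1 by apply/enorm_eq1/g1.
have {}dg1 s : dot (derive1 g s) (derive1 g s) = 1 by apply/enorm_eq1/dg1.
have gdg s : dot (g s) (derive1 g s) = 0.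
  have [_] := is_derive_dot (dg s) (dg s).
  under eq_fun do rewrite g1.
  by rewrite derive_cst dotC => /esym; lra.
have gddg s : dot (g s) (derive1 (derive1 g) s) = -1.
  have [_] := is_derive_dot (dg s) (ddg s).
  under eq_fun do rewrite gdg.
  by rewrite derive_cst dg1 => /esym; lra.
have ddgE s : derive1 (derive1 g) s = - g s.
  (* The sum [v + g s] is tangent to the sphere, so [geo] makes it orthogonal to [v] as well, hence
     to itself. *)
  set v := derive1 _ s; suff : v + g s = 0 by move/eqP; rewrite addr_eq0 => /eqP.
  have vg : dot (v + g s) (g s) = 0 by rewrite dotDl g1 dotC gddg addNr.
  by apply: dot_eq0; rewrite dotDr vg addr0; exact: geo.
split=> //; apply/funext => s; apply/rowP => i.
(* First integrals of the oscillator equation. *)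
pose p s := cos s * g s 0 i - sin s * derive1 g s 0 i.
pose q s := sin s * g s 0 i + cos s * derive1 g s 0 i.
have dgi s' := is_derive_coord i (dg s').
have ddgi s' := is_derive_coord i (ddg s').
have pE s' : p s' = p t.
  apply: is_derive_0_is_cst => x.
  have -> : p = (@cos R) * (fun s => g s 0 i) - (@sin R) * (fun s => derive1 g s 0 i) by [].
  by apply: is_derive_eq; rewrite ddgE mxE !scaleR_mul; ring.
have qE s' : q s' = q t.
  apply: is_derive_0_is_cst => x.
  have -> : q = (@sin R) * (fun s => g s 0 i) + (@cos R) * (fun s => derive1 g s 0 i) by [].
  apply: (is_derive_eq (is_deriveD (is_deriveM (is_derive_sin x) (dgi x))
    (is_deriveM (is_derive_cos x) (ddgi x)))).
  by rewrite ddgE mxE !scaleR_mul; ring.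
have -> : g s 0 i = cos s * p s + sin s * q s.
  rewrite -[LHS]mul1r -(cos2Dsin2 s) /p /q; ring.
by rewrite pE qE !mxE cosB sinB /p /q; ring.
Qed.

(** * Axial and plane components, meridians and reflections *)

Definition axial (R : realType) (n : nat) (x : ambient R n) : 'rV[R]_n.-1 :=
  lsubmx x.
Definition xc (R : realType) (n : nat) (x : ambient R n) : R := rsubmx x 0 0.
Definition yc (R : realType) (n : nat) (x : ambient R n) : R := rsubmx x 0 1.

(** Determinant of the plane components. For a point and the velocity of a great circle, it is
    nonzero exactly when the projection to the plane is a nondegenerate ellipse. *)
Definition wedge (R : realType) (n : nat) (u v : ambient R n) : R :=
  xc u * yc v - yc u * xc v.

Section Coordinates.
Variables (R : realType) (n : nat).
Implicit Types (x y u v : ambient R n) (w : 'rV[R]_n.-1) (a b c phi : R).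

Lemma axialD x y : axial (x + y) = axial x + axial y.
Proof. exact: linearD. Qed.
Lemma axialZ c x : axial (c *: x) = c *: axial x.
Proof. exact: linearZ. Qed.
Lemma axialN x : axial (- x) = - axial x.
Proof. exact: linearN. Qed.
Lemma xcD x y : xc (x + y) = xc x + xc y.
Proof. by rewrite /xc !mxE. Qed.
Lemma ycD x y : yc (x + y) = yc x + yc y.
Proof. by rewrite /yc !mxE. Qed.
Lemma xcZ c x : xc (c *: x) = c * xc x.
Proof. by rewrite /xc !mxE. Qed.
Lemma ycZ c x : yc (c *: x) = c * yc x.
Proof. by rewrite /yc !mxE. Qed.
Lemma xcN x : xc (- x) = - xc x.
Proof. by rewrite /xc !mxE. Qed.
Lemma ycN x : yc (- x) = - yc x.
Proof. by rewrite /yc !mxE. Qed.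
Lemma axial_pt w a b : axial (pt w a b) = w.
Proof. by rewrite /axial row_mxKl. Qed.
Lemma xc_pt w a b : xc (pt w a b) = a.
Proof. by rewrite /xc row_mxKr mxE. Qed.
Lemma yc_pt w a b : yc (pt w a b) = b.
Proof. by rewrite /yc row_mxKr mxE. Qed.

Definition coordE := (axialD, axialZ, axialN, xcD, ycD, xcZ, ycZ, xcN, ycN,
  axial_pt, xc_pt, yc_pt).

Lemma coord_inj x y :
  axial x = axial y -> xc x = xc y -> yc x = yc y -> x = y.
Proof.
move=> wxy xxy yxy; rewrite -(hsubmxK x) -(hsubmxK y); congr (row_mx _ _) => //.
apply/rowP => -[[|[|//]] j].
  by rewrite (_ : Ordinal j = 0)//; apply/val_inj.
by rewrite (_ : Ordinal j = 1)//; apply/val_inj.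
Qed.

Lemma dot_coord x y :
  dot x y = dot (axial x) (axial y) + xc x * xc y + yc x * yc y.
Proof.
rewrite /dot big_split_ord/= -addrA; congr (_ + _).
  by apply: eq_bigr => i _; rewrite !mxE.
rewrite !big_ord_recl big_ord0 addr0 /xc /yc !mxE.
by have -> : lift ord0 ord0 = 1 :> 'I_2 by apply/val_inj.
Qed.

(** Trades the parameter [w] for a radius [rho]: on the sphere, membership only asks the plane
    component to lie on the closed half-line of angle [phi]. *)
Lemma meridianP phi x : @meridian R n phi x <-> dot x x = 1 /\
  exists2 rho, 0 <= rho & xc x = rho * cos phi /\ yc x = rho * sin phi.
Proof.
have cs := cos2Dsin2 phi; split.
  move=> [w [w1 /= ->]]; set r := Num.sqrt _.
  have r2 : r ^+ 2 = 1 - dot w w.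
    rewrite sqr_sqrtr ?enorm_sqr// -enorm_sqr subr_ge0.
    by rewrite -[1](expr1n _ 2) lerXn2r ?nnegrE ?sqrtr_ge0.
  split; last by exists r; rewrite ?sqrtr_ge0// !coordE.
  rewrite dot_coord !coordE -!expr2 !exprMn -addrA -mulrDr cs mulr1 r2; ring.
move=> [x1 [rho rho0 [xx yx]]]; exists (axial x).
have w2 : dot (axial x) (axial x) = 1 - rho ^+ 2.
  move: x1; rewrite dot_coord xx yx -!expr2 !exprMn -addrA -mulrDr cs mulr1 => <-.
  by rewrite addrK.
split.
  by rewrite -sqrtr1 ler_wsqrtr// w2 lerBlDr lerDl sqr_ge0.
rewrite /= enorm_sqr w2 subKr sqrtr_sqr ger0_norm//.
by apply: coord_inj; rewrite !coordE.
Qed.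

(** Both radii equal the norm of the plane component, which is nonzero off the polar sphere, so they
    cancel and [cos_sin_inj] applies. *)
Lemma meridian_inj a b x : `|a - b| < 2 * pi -> (xc x != 0) || (yc x != 0) ->
  meridian a x -> meridian b x -> a = b.
Proof.
move=> ab x0 /meridianP[_ [r r0 [xr yr]]] /meridianP[_ [q q0 [xq yq]]].
have ra := cos2Dsin2 a; have rb := cos2Dsin2 b.
have : r ^+ 2 = q ^+ 2.
  transitivity (xc x ^+ 2 + yc x ^+ 2).
    by rewrite xr yr !exprMn -mulrDr ra mulr1.
  by rewrite xq yq !exprMn -mulrDr rb mulr1.
move=> /eqP; rewrite eqrXn2// => /eqP rq; subst q.
have {}r0 : r != 0.
  by apply: contraTneq x0 => r00; rewrite xr yr r00 !mul0r eqxx.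
by apply: cos_sin_inj => //; apply: (mulfI r0); [rewrite -xr xq|rewrite -yr yq].
Qed.

Lemma polar_sphereE x : polar_sphere x <-> [/\ dot x x = 1, xc x = 0 & yc x = 0].
Proof.
rewrite /polar_sphere /sphere; split=> [[/= /enorm_eq1 x1 [w xw]]|[x1 x0 y0]].
  by rewrite x1 xw !coordE.
split; first exact/enorm_eq1.
by exists (axial x); apply: coord_inj; rewrite !coordE.
Qed.

Lemma reflectionD phi x y : reflection phi (x + y) = reflection phi x + reflection phi y.
Proof.
by rewrite /reflection dotDl mulrDr scalerDl opprD addrACA.
Qed.

Lemma reflectionZ phi c x : reflection phi (c *: x) = c *: reflection phi x.
Proof. by rewrite /reflection dotZl scalerBr scalerA mulrCA. Qed.

Lemma dot_meridian_normal phi x :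
  dot x (meridian_normal n phi) = yc x * cos phi - xc x * sin phi.
Proof. by rewrite dot_coord !coordE dotC dot0l; ring. Qed.

Lemma axial_reflection phi x : axial (reflection phi x) = axial x.
Proof. by rewrite /reflection !coordE scaler0 oppr0 addr0. Qed.

(** First row of the planar reflection matrix. In terms of the double angle, composing two
    reflections reduces to the addition formulas. *)
Lemma xc_reflection phi x :
  xc (reflection phi x) = cos (phi *+ 2) * xc x + sin (phi *+ 2) * yc x.
Proof.
rewrite /reflection !coordE dot_meridian_normal sin_mulr2n cos_mulr2n cos2sin2.
by rewrite !mulr2n; ring.
Qed.

Lemma yc_reflection phi x :
  yc (reflection phi x) = sin (phi *+ 2) * xc x - cos (phi *+ 2) * yc x.
Proof.
rewrite /reflection !coordE dot_meridian_normal sin_mulr2n cos_mulr2n.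
by rewrite !mulr2n; ring.
Qed.

Lemma dot_reflection phi x y :
  dot (reflection phi x) (reflection phi y) = dot x y.
Proof.
rewrite !dot_coord !axial_reflection !xc_reflection !yc_reflection -!addrA.
congr (_ + _); rewrite -[RHS]mul1r -(cos2Dsin2 (phi *+ 2)); ring.
Qed.

Lemma wedge_reflection phi x y :
  wedge (reflection phi x) (reflection phi y) = - wedge x y.
Proof.
rewrite /wedge !xc_reflection !yc_reflection.
rewrite -[in RHS](mul1r (_ - _)) -(cos2Dsin2 (phi *+ 2)); ring.
Qed.

Lemma reflection_fix phi x : meridian phi x -> reflection phi x = x.
Proof.
move=> /meridianP[_ [r _ [xr yr]]].
rewrite /reflection dot_meridian_normal xr yr -mulrA [sin _ * _]mulrC mulrA.
by rewrite subrr mulr0 scale0r subr0.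
Qed.

End Coordinates.

(** * Crossings of a great circle with the meridians *)

Section Geodesic.
Variables (R : realType) (n : nat).
Implicit Types (a b : ambient R n) (h g : R -> ambient R n) (phi alpha beta s t : R).

Lemma wedge_great_circle a b t s :
  wedge a (great_circle a b t s) = sin (s - t) * wedge a b.
Proof. by rewrite /wedge !coordE; ring. Qed.

Lemma wedge_velocity a b t s :
  wedge (great_circle a b t s) (derive1 (great_circle a b t) s) = wedge a b.
Proof.
rewrite derive1_great_circle /wedge !coordE -[RHS]mul1r -(cos2Dsin2 (s - t)); ring.
Qed.

Lemma wedge_neq0 a b : wedge a b != 0 -> (xc a != 0) || (yc a != 0).
Proof.
by apply: contraNT; rewrite negb_or !negbK /wedge => /andP[/eqP -> /eqP ->]; rewrite !mul0r subrr.
Qed.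

(** Two points over the same half-line have zero [wedge], so the sine vanishes; a cosine equal to -1
    would carry [a] to the opposite half-line. *)
Lemma meridian_return a b t s phi : wedge a b != 0 ->
  meridian phi a -> meridian phi (great_circle a b t s) ->
  cos (s - t) = 1 /\ sin (s - t) = 0.
Proof.
move=> ab0 ma ms; have := wedge_great_circle a b t s.
have cs := cos2Dsin2 phi.
have /meridianP[_ [r r0 [xr yr]]] := ma; have /meridianP[_ [q q0 [xq yq]]] := ms.
rewrite {1}/wedge xr yr xq yq (_ : _ - _ = 0); last by ring.
move=> /esym/eqP; rewrite mulf_eq0 (negPf ab0) orbF => /eqP sin0.
split=> //; have := cos2Dsin2 (s - t); rewrite sin0 expr0n addr0 => /eqP.
rewrite sqrf_eq1 => /predU1P[//|/eqP cN].
have {}r0 : 0 < r.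
  rewrite lt_def r0 andbT; apply: contraTneq (wedge_neq0 ab0) => r00.
  by rewrite xr yr r00 !mul0r eqxx.
(* The plane component at time [s] is here the opposite of that of [a], so q = - r, whereas r > 0
   and q >= 0. *)
suff : r + q = 0 by lra.
rewrite -[LHS]mulr1 -cs; move: xq yq; rewrite !coordE sin0 cN xr yr !mul0r !addr0.
rewrite !expr2 => xq yq; rewrite mulrDr !mulrDl !mulrA -xq -yq; ring.
Qed.

Lemma meridian_hit a b t beta : dot a a = 1 -> dot b b = 1 -> dot a b = 0 ->
  wedge a b != 0 ->
  exists2 s, t <= s < t + 2 * pi & meridian beta (great_circle a b t s).
Proof.
move=> aa bb ab ab0; have cs := cos2Dsin2 beta.
(* Cramer's rule for u a + v b = (cos beta, sin beta) in the plane factor. *)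
pose u := (cos beta * yc b - sin beta * xc b) / wedge a b.
pose v := (xc a * sin beta - yc a * cos beta) / wedge a b.
have ux : u * xc a + v * xc b = cos beta by rewrite /u /v; move: ab0; rewrite /wedge => ?; field.
have uy : u * yc a + v * yc b = sin beta by rewrite /u /v; move: ab0; rewrite /wedge => ?; field.
clearbody u v; have uv0 : 0 < u ^+ 2 + v ^+ 2.
  rewrite lt_def addr_ge0 ?sqr_ge0// andbT paddr_eq0 ?sqr_ge0// !sqrf_eq0.
  apply/negP => /andP[/eqP u0 /eqP v0]; move: cs; rewrite -ux -uy u0 v0.
  by rewrite !mul0r !addr0 expr0n addr0 => /esym/eqP; rewrite oner_eq0.
(* Normalised, [(u, v)] is the cosine and sine of the elapsed time; the plane component reached is
   then 1 / N times the unit vector of angle [beta]. *)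
set N := Num.sqrt (u ^+ 2 + v ^+ 2); have N0 : 0 < N by rewrite sqrtr_gt0.
have N2 : N ^+ 2 = u ^+ 2 + v ^+ 2 by rewrite sqr_sqrtr// ltW.
have [|s s02 [cN sN]] := @cos_sin_surj _ (u / N) (v / N).
  by rewrite !exprMn -mulrDl -N2 -exprMn divff ?expr1n ?gt_eqF.
exists (s + t); first by move: s02 => /andP[? ?]; apply/andP; split; lra.
apply/meridianP; split; first exact: dot_great_circle.
exists N^-1; first by rewrite invr_ge0 ltW.
rewrite !coordE addrK cN sN -ux -uy; split; ring.
Qed.

(** The half-line [beta] is met before time t + 2 pi, while a return to [alpha] takes at least 2 pi;
    so the first boundary point met is not on [alpha]. *)
Lemma meridian_next a b t s alpha beta :
  dot a a = 1 -> dot b b = 1 -> dot a b = 0 -> wedge a b != 0 ->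
  0 < `|alpha - beta| < 2 * pi -> meridian alpha a -> t < s ->
  (@meridian R n alpha `|` @meridian R n beta) (great_circle a b t s) ->
  (forall r, t < r < s ->
     ~ (@meridian R n alpha `|` @meridian R n beta) (great_circle a b t r)) ->
  meridian beta (great_circle a b t s).
Proof.
move=> aa bb ab ab0 /andP[ab1 ab2] ma ts [ms|//] nhit.
have [r /andP[]] := meridian_hit t beta aa bb ab ab0.
rewrite le_eqVlt => /predU1P[<- _|tr r2 mr].
  rewrite /great_circle subrr cos0 sin0 scale1r scale0r addr0 => mb.
  move: ab1; rewrite (meridian_inj ab2 (wedge_neq0 ab0) ma mb) subrr normr0.
  by rewrite ltxx.
have [rs|sr] := ltP r s; first by have := nhit r; rewrite tr rs => /(_ isT)[]; right.
have [c1 _] := meridian_return ab0 ma ms.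
suff /cos_lt1 : 0 < s - t < 2 * pi by rewrite c1 ltxx.
by apply/andP; split; lra.
Qed.

(** If the determinant vanished, the great circle would project into the line y = 0, unless it
    already starts on the polar sphere; moving along that line, it would pass over the origin and so
    meet the polar sphere. *)
Lemma wedge_admissible theta t h :
  admissible theta t h -> wedge (h t) (derive1 h t) != 0.
Proof.
move=> [geo m0 _ npol]; apply/negP => /eqP w0.
have [aa bb ab hE] := unit_speed_geodesicP t geo.
have /meridianP[_ [r r0]] := m0; rewrite cos0 sin0 mulr1 mulr0 => -[xr yr].
move: w0; rewrite /wedge xr yr mul0r subr0 => /eqP; rewrite mulf_eq0.
move: r0; rewrite le_eqVlt => /predU1P[r0 _|r0].
  by apply: (npol t); apply/polar_sphereE; split => //; rewrite xr.
rewrite gt_eqF//= => /eqP yb0; set x := xc (derive1 h t).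
have N0 : 0 < r ^+ 2 + x ^+ 2 by rewrite ltr_wpDr ?sqr_ge0 ?exprn_gt0.
set N := Num.sqrt (r ^+ 2 + x ^+ 2).
have N0' : N != 0 by rewrite gt_eqF// sqrtr_gt0.
(* At this [s], [(cos s, sin s)] is proportional to [(- x, r)], which kills r cos s + x sin s, the
   first plane coordinate. *)
have [|s _ [cN sN]] := @cos_sin_surj _ (- x / N) (r / N).
  by rewrite !exprMn sqrrN -mulrDl addrC -[X in X * _]sqr_sqrtr ?ltW// -exprMn divff ?expr1n.
apply: (npol (s + t)); apply/polar_sphereE; rewrite hE; split.
- exact: dot_great_circle.
- by rewrite !coordE addrK cN sN xr -/x; ring.
- by rewrite !coordE yr yb0 !mulr0 addr0.
Qed.

End Geodesic.

(** * Unfolding a trajectory into its initial geodesic *)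

Section Trajectory.
Variables (R : realType) (n : nat) (theta : R).

(** Angle of the meridian on which collision [i] is going to be located, index 0 being the start. *)
Definition wall (i : nat) : R := if odd i then theta else 0.

(* Maps the initial geodesic to the i-th one. *)
Fixpoint fold (i : nat) (x : ambient R n) : ambient R n :=
  if i is j.+1 then reflection (wall i) (fold j x) else x.

Lemma fold_great_circle i a b t :
  (fun s => fold i (great_circle a b t s)) = great_circle (fold i a) (fold i b) t.
Proof.
apply/funext => s; elim: i => //= i ->.
by rewrite reflectionD !reflectionZ.
Qed.

Lemma dot_fold i x y : dot (fold i x) (fold i y) = dot x y.
Proof. by elim: i => //= i IHi; rewrite dot_reflection. Qed.

Lemma axial_fold i x : axial (fold i x) = axial x.
Proof. by elim: i => //= i IHi; rewrite axial_reflection. Qed.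

Lemma wedge_fold i x y : wedge (fold i x) (fold i y) = (-1) ^+ i * wedge x y.
Proof.
elim: i => /= [|i IHi]; first by rewrite mul1r.
by rewrite wedge_reflection IHi exprS mulN1r mulNr.
Qed.

(* Rotation of angle - 2 j theta of the plane factor. *)
Lemma fold_double j x :
  xc (fold j.*2 x) =
    cos (j%:R * (2 * theta)) * xc x + sin (j%:R * (2 * theta)) * yc x /\
  yc (fold j.*2 x) =
    cos (j%:R * (2 * theta)) * yc x - sin (j%:R * (2 * theta)) * xc x.
Proof.
elim: j => [|j [IHx IHy]].
  by rewrite double0 mul0r /= cos0 sin0 !mul1r !mul0r addr0 subr0.
have -> : j.+1%:R * (2 * theta) = j%:R * (2 * theta) + theta *+ 2.
  by rewrite -natr1 mulr2n; ring.
rewrite doubleS /= !(xc_reflection, yc_reflection) /wall /= odd_double /=.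
rewrite mul0rn cos0 sin0 IHx IHy; move: (theta *+ 2) (_ * (2 * theta)) => d e.
by rewrite cosD sinD; split; ring.
Qed.

Hypothesis theta_bd : 0 < theta < 2 * pi.
Variables (t : nat -> R) (g : nat -> R -> ambient R n).
Hypothesis traj : billiard_trajectory theta t g.

Let A := g 0%N (t 0%N).
Let B := derive1 (g 0%N) (t 0%N).

Lemma wall_dist i : `|wall i - wall i.+1| = theta.
Proof.
have /andP[t0 _] := theta_bd.
by rewrite /wall /=; case: odd; rewrite ?subr0 ?sub0r ?normrN gtr0_norm.
Qed.

Lemma lune_boundary_wall i :
  @lune_boundary R n theta = @meridian R n (wall i) `|` @meridian R n (wall i.+1).
Proof. by rewrite /lune_boundary /wall /=; case: odd => //=; rewrite setUC. Qed.

Lemma trajectory_start :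
  [/\ dot A A = 1, dot B B = 1, dot A B = 0 & g 0%N = great_circle A B (t 0%N)].
Proof. by apply: unit_speed_geodesicP; have [[]] := traj. Qed.

Lemma trajectory_wedge : wedge A B != 0.
Proof. by apply: (@wedge_admissible _ _ theta); have [] := traj. Qed.

(** Induction: segment [i] starts on [wall i], so [meridian_next] puts its end on [wall i.+1]. The
    reflection there fixes the collision point, and position and velocity determine a great circle,
    so the new geodesic is the reflected old one. *)
Lemma trajectory_fold i :
  g i = (fun s => fold i (g 0%N s)) /\ meridian (wall i) (g i (t i)).
Proof.
have [aa bb ab gE] := trajectory_start.
elim: i => [|i [IHg IHm]].
  by split; [apply/funext|have [[]] := traj].
have [[tt hit nhit] [geo cont refl]] := traj.2 i.
have giE : g i = great_circle (fold i A) (fold i B) (t 0%N).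
  by rewrite IHg gE fold_great_circle.
have geoi : unit_speed_geodesic (g i).
  by rewrite giE; apply: unit_speed_geodesic_great_circle; rewrite dot_fold.
have wi s : wedge (g i s) (derive1 (g i) s) != 0.
  by rewrite giE wedge_velocity wedge_fold mulf_eq0 negb_or trajectory_wedge signr_eq0.
have [aai bbi abi giEi] := unit_speed_geodesicP (t i) geoi.
have mi : meridian (wall i.+1) (g i (t i.+1)).
  rewrite giEi; apply: (meridian_next _ _ _ (wi _) _ IHm) => //.
  - by rewrite wall_dist.
  - by rewrite -lune_boundary_wall -giEi.
  - by rewrite -lune_boundary_wall -giEi.
(* The reflection law leaves the angle existential; off the polar sphere the collision point
   determines it. *)
have dE : derive1 (g i.+1) (t i.+1) = reflection (wall i.+1) (derive1 (g i) (t i.+1)).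
  have [phi [phiE mphi ->]] := refl; congr (reflection _ _).
  apply: meridian_inj (wedge_neq0 (wi _)) mphi mi.
  have /andP[t0 t2] := theta_bd; have p0 := @pi_gt0 R.
  by case: phiE => ->; rewrite /wall; case: odd; rewrite ?subr0 ?sub0r ?normrN ?subrr ?normr0 ?gtr0_norm//; lra.
split; last by rewrite cont.
have [_ _ _ ->] := unit_speed_geodesicP (t i.+1) geo.
rewrite cont dE -(reflection_fix mi).
have [_ _ _ giE'] := unit_speed_geodesicP (t i.+1) geoi.
apply/funext => s /=.
rewrite (_ : fold i (g 0%N s) = g i s); last by rewrite IHg.
rewrite [in RHS]giE' /great_circle reflectionD !reflectionZ reflection_fix//.
Qed.

End Trajectory.

(** * Periods, commensurability and orthogonality *)

Lemma rotation_fix (R : realType) (k : nat) (T : R) (u v : 'rV[R]_k) :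
  cos T != 1 -> cos T *: u + sin T *: v = u -> cos T *: v - sin T *: u = v ->
  u = 0 /\ v = 0.
Proof.
move=> c1 uE vE; have cs := cos2Dsin2 T.
(* This is the determinant of the identity minus the rotation of angle [T]; the two [transitivity]
   steps multiply by its adjugate. *)
have c2 : 2 * (1 - cos T) != 0 by rewrite mulf_neq0// subr_eq0 eq_sym.
suff h i : u 0 i = 0 /\ v 0 i = 0 by split; apply/rowP => i; rewrite mxE; case: (h i).
move/rowP/(_ i): uE; move/rowP/(_ i): vE; rewrite !mxE.
move: (u 0 i) (v 0 i) => a b bE aE; split; apply: (mulfI c2); rewrite mulr0.
  transitivity ((1 - cos T) * (a - (cos T * a + sin T * b))
    + sin T * (b - (cos T * b - sin T * a))
    + (1 - (cos T ^+ 2 + sin T ^+ 2)) * a); first by ring.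
  by rewrite bE aE cs !subrr !mulr0 mul0r !addr0.
transitivity ((1 - cos T) * (b - (cos T * b - sin T * a))
  - sin T * (a - (cos T * a + sin T * b))
  + (1 - (cos T ^+ 2 + sin T ^+ 2)) * b); first by ring.
by rewrite bE aE cs !subrr !mulr0 mul0r oppr0 !addr0.
Qed.

Section Periods.
Variables (R : realType) (n : nat) (theta : R).
Hypothesis theta_bd : 0 < theta < 2 * pi.
Variables (t : nat -> R) (g : nat -> R -> ambient R n).
Hypothesis traj : billiard_trajectory theta t g.

Let A := g 0%N (t 0%N).
Let B := derive1 (g 0%N) (t 0%N).

Lemma trajectory_great_circle i :
  g i = great_circle (fold theta i A) (fold theta i B) (t 0%N).
Proof.
have [-> _] := trajectory_fold theta_bd traj i.
by have [_ _ _ ->] := trajectory_start traj; rewrite fold_great_circle.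
Qed.

Lemma trajectory_neq0 i s : (xc (g i s) != 0) || (yc (g i s) != 0).
Proof.
apply: (@wedge_neq0 _ _ _ (derive1 (g i) s)); rewrite trajectory_great_circle.
by rewrite wedge_velocity wedge_fold mulf_eq0 negb_or signr_eq0 (trajectory_wedge traj).
Qed.

Lemma trajectory_start_meridian : meridian 0 A.
Proof. by have [[]] := traj. Qed.

Lemma trajectory_start_coord : 0 < xc A /\ yc A = 0.
Proof.
have := trajectory_neq0 0 (t 0%N); rewrite -/A.
have /meridianP[_ [r r0]] := trajectory_start_meridian.
rewrite cos0 sin0 mulr1 mulr0 => -[-> ->].
by rewrite eqxx orbF lt_def r0 andbT.
Qed.

Lemma start_wall0 phi : phi = 0 \/ phi = theta -> meridian phi A -> phi = 0.
Proof.
move=> phiE mphi; have /andP[t0 t2] := theta_bd; have p0 := @pi_gt0 R.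
apply: meridian_inj (trajectory_neq0 0 (t 0%N)) mphi trajectory_start_meridian.
by case: phiE => ->; rewrite subr0 ?normr0 ?gtr0_norm//; lra.
Qed.

(** [A] lies only on the wall of angle 0, so the closing reflection is the one leading from segment
    [q.-1] to segment [q]. For odd [q] the collision would be on the other wall. *)
Lemma period_closes q : has_period theta t g q ->
  [/\ ~~ odd q, g q (t q) = A & derive1 (g q) (t q) = B].
Proof.
case: q => [[]//|q [_ gq rq]]; have [_ [_ cont [phi [phiE mphi dg]]]] := traj.2 q.
have gqE : g q.+1 (t q.+1) = A by rewrite cont.
have /andP[t0 _] := theta_bd.
split=> //.
  apply/negP => oq; have [_] := trajectory_fold theta_bd traj q.+1.
  rewrite gqE => /start_wall0; rewrite /wall oq => /(_ (or_intror erefl)) tE.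
  by move: t0; rewrite tE ltxx.
case: rq => psi [psiE mpsi dg0]; rewrite dg /B dg0.
by rewrite (start_wall0 psiE mpsi) (@start_wall0 phi)//; rewrite gq in mphi.
Qed.

Lemma closes_period q : (0 < q)%N ->
  g q (t q) = A -> derive1 (g q) (t q) = B -> has_period theta t g q.
Proof.
case: q => // q _ gq dgq; have [_ [_ cont refl]] := traj.2 q.
have gqE : g q (t q.+1) = A by rewrite -cont.
by split=> //; rewrite /= -/A -/B -dgq -gqE.
Qed.

Lemma period_commensurable q : has_period theta t g q ->
  (axial A <> 0 \/ axial B <> 0) ->
  exists k : int, (q./2)%:R * theta = k%:~R * pi.
Proof.
move=> /period_closes[eq gq dgq] wAB.
move: gq dgq; rewrite trajectory_great_circle derive1_great_circle.
set T := t q - t 0%N => gq dgq.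
(* Reflections leave the axial parts alone, so closing up makes this pair invariant under a rotation
   of angle [T]; if cos T differs from 1, both parts vanish. *)
have [c1|c1] := eqVneq (cos T) 1; last first.
  have wA : cos T *: axial A + sin T *: axial B = axial A.
    by rewrite -[in RHS]gq !coordE !axial_fold.
  have wB : cos T *: axial B - sin T *: axial A = axial B.
    by rewrite -[in RHS]dgq !coordE !axial_fold scalerN.
  by case: (rotation_fix c1 wA wB) wAB => -> -> [].
have s0 : sin T = 0.
  by have := cos2Dsin2 T; rewrite c1 expr1n => /eqP; rewrite -subr_eq0 addrAC subrr add0r sqrf_eq0 => /eqP.
have [x0 y0] := trajectory_start_coord.
(* The elapsed time is now a multiple of 2 pi, so the closing point is the image of [A] itself. As
   [A] projects to the positive first axis, its first coordinate alone detects the angle of the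
   rotation. *)
have fA : fold theta (q./2).*2 A = A.
  rewrite -[in RHS]gq -/T /great_circle -/T c1 s0 scale1r scale0r addr0.
  by rewrite even_halfK.
have [fx _] := fold_double theta q./2 A.
move: fx; rewrite fA y0 mulr0 addr0 => fx.
have /cos_eq1[k kE] : cos ((q./2)%:R * (2 * theta)) = 1.
  have x0' : xc A != 0 by rewrite gt_eqF.
  by apply: (mulIf x0'); rewrite -fx mul1r.
by exists k; lra.
Qed.

Lemma commensurable_period (j : nat) (k : int) : (0 < j)%N ->
  j%:R * theta = k%:~R * pi -> has_period theta t g j.*2.
Proof.
move=> j0 jk.
have jE : j%:R * (2 * theta) = 0 + k%:~R * (2 * pi) by lra.
have foldE x : fold theta j.*2 x = x :> ambient R n.
  have [fx fy] := fold_double theta j x.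
  move: fx fy; rewrite jE cosD2piz sinD2piz cos0 sin0 !mul1r !mul0r addr0 subr0.
  by move=> fx fy; apply: coord_inj => //; rewrite axial_fold.
have gE : g j.*2 = great_circle A B (t 0%N) by rewrite trajectory_great_circle !foldE.
have [_] := trajectory_fold theta_bd traj j.*2.
rewrite /wall odd_double gE => mer.
(* Start and collision lie over the half-line of angle 0 on the same great circle, so the elapsed
   time is a multiple of 2 pi; this closes the velocity too. *)
have [c1 s0] := meridian_return (trajectory_wedge traj) trajectory_start_meridian mer.
apply: closes_period; first by rewrite double_gt0.
  by rewrite gE /great_circle c1 s0 scale1r scale0r addr0.
by rewrite gE derive1_great_circle /great_circle c1 s0 scale1r scale0r addr0.
Qed.

Lemma flat_axial i s : axial A = 0 -> axial B = 0 ->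
  axial (g i s) = 0 /\ axial (derive1 (g i) s) = 0.
Proof.
move=> A0 B0; rewrite trajectory_great_circle derive1_great_circle.
by rewrite !coordE !axial_fold A0 B0 oppr0 !scaler0 addr0.
Qed.

(** Without axial part, the point is the unit vector of angle 0, and a tangent vector there keeps a
    single coordinate, which is the determinant. *)
Lemma flat_velocity (a b : ambient R n) : axial a = 0 -> axial b = 0 ->
  dot a a = 1 -> dot a b = 0 -> meridian 0 a -> a = pt 0 1 0 /\ b = pt 0 0 (wedge a b).
Proof.
move=> a0 b0 aa ab /meridianP[_ [r r0]]; rewrite cos0 sin0 mulr1 mulr0 => -[xr yr].
move: aa ab; rewrite /wedge !dot_coord a0 !dot0l xr yr !(mul0r, add0r, addr0, subr0) => aa ab.
have r1 : r = 1 by apply/eqP; rewrite -(@eqrXn2 _ 2) ?expr1n ?expr2 ?aa.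
move: ab; rewrite r1 !mul1r => xb; split; apply: coord_inj; rewrite !coordE//.
by rewrite xr r1.
Qed.

Lemma flat_start : axial A = 0 -> axial B = 0 ->
  A = pt 0 1 0 /\ B = pt 0 0 (wedge A B).
Proof.
move=> A0 B0; have [aa _ ab _] := trajectory_start traj.
by apply: flat_velocity => //; exact: trajectory_start_meridian.
Qed.

(** Collision 2 is again on the wall of angle 0, and two reflections preserve the determinant, so
    [flat_velocity] yields the initial position and velocity, whatever the opening angle. *)
Lemma flat_period : axial A = 0 -> axial B = 0 -> has_period theta t g 2.
Proof.
move=> A0 B0; have [AE BE] := flat_start A0 B0.
have [aa bb ab _] := trajectory_start traj.
have [a2 b2] := flat_axial 2 (t 2) A0 B0.
have geo : unit_speed_geodesic (g 2).
  by rewrite trajectory_great_circle; apply: unit_speed_geodesic_great_circle; rewrite dot_fold.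
have [aa2 _ ab2 _] := unit_speed_geodesicP (t 2) geo.
have [_ m2] := trajectory_fold theta_bd traj 2.
have [AE2 BE2] := flat_velocity a2 b2 aa2 ab2 m2.
apply: closes_period => //; first by rewrite AE2.
rewrite BE2 [RHS]BE; congr (pt _ _ _).
by rewrite trajectory_great_circle wedge_velocity wedge_fold sqrrN expr1n mul1r.
Qed.

(** Orthogonality to a meridian makes the velocity a multiple of the meridian normal, which has no
    axial part. Using this at two times of the first segment kills the axial parts of [B], then of
    [A]. *)
Lemma orthogonal_flat :
  orthogonal_to_meridians t g <-> axial A = 0 /\ axial B = 0.
Proof.
split=> [orth|[A0 B0] i s phi _ mer u [ux uN]]; last first.
  have [a0 b0] := flat_axial i s A0 B0.
  have /meridianP[x1 [r r0 [xr yr]]] := mer; have cs := cos2Dsin2 phi.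
  move: ux uN x1; rewrite dot_meridian_normal !dot_coord a0 b0 dotC !dot0l xr yr.
  rewrite !add0r => ux uN r1.
  have r2 : r ^+ 2 = 1 by rewrite -[RHS]r1 -[LHS]mulr1 -cs; ring.
  have {r1 r2}r1 : r = 1 by apply/eqP; rewrite -(@eqrXn2 _ 2) ?expr1n ?r2.
  move: ux; rewrite r1 !mul1r => ux.
  (* In the plane factor [u] is orthogonal to both the radial and the normal unit vector, so its
     plane component is zero. *)
  have -> : xc u = 0.
    rewrite -[LHS]mulr1 -cs.
    transitivity (cos phi * (xc u * cos phi + yc u * sin phi)
      - sin phi * (yc u * cos phi - xc u * sin phi)); first by ring.
    by rewrite ux uN !mulr0 subr0.
  have -> : yc u = 0.
    rewrite -[LHS]mulr1 -cs.
    transitivity (sin phi * (xc u * cos phi + yc u * sin phi)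
      + cos phi * (yc u * cos phi - xc u * sin phi)); first by ring.
    by rewrite ux uN !mulr0 addr0.
  by rewrite !mul0r addr0.
have [aa bb ab gE] := trajectory_start traj.
have flat s : t 0%N <= s <= t 1%N -> axial (derive1 (g 0%N) s) = 0.
  move=> st; have geo : unit_speed_geodesic (g 0%N) by have [[]] := traj.
  have [x1 v1 xv _] := unit_speed_geodesicP s geo.
  have xy0 := trajectory_neq0 0 s.
  have [phi mphi] : exists phi, meridian phi (g 0%N s).
    move: (g 0%N s) x1 xy0 => x x1 xy0.
    have N0 : 0 < xc x ^+ 2 + yc x ^+ 2.
      rewrite lt_def addr_ge0 ?sqr_ge0// andbT paddr_eq0 ?sqr_ge0// !sqrf_eq0.
      by rewrite negb_and.
    set N := Num.sqrt (xc x ^+ 2 + yc x ^+ 2).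
    have N2 : N ^+ 2 = xc x ^+ 2 + yc x ^+ 2 by rewrite sqr_sqrtr// ltW.
    have {}N0 : N != 0 by rewrite gt_eqF// sqrtr_gt0.
    have [|phi _ [cN sN]] := @cos_sin_surj _ (xc x / N) (yc x / N).
      by rewrite !exprMn -mulrDl -N2 -exprMn divff ?expr1n.
    exists phi; apply/meridianP; split=> //; exists N; first exact: sqrtr_ge0.
    by rewrite cN sN ![N * _]mulrC !divfK.
  set v := derive1 _ s in v1 xv *; set N := meridian_normal n phi.
  have xN : dot (g 0%N s) N = 0.
    have /meridianP[_ [r _ [xr yr]]] := mphi.
    by rewrite dot_meridian_normal xr yr; ring.
  have NN : dot N N = 1.
    by rewrite dot_meridian_normal /N /meridian_normal !coordE -(cos2Dsin2 phi); ring.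
  (* The tangential part u of the velocity is orthogonal to itself. *)
  have [u uE] : exists u, u = v - dot v N *: N by exists (v - dot v N *: N).
  have uN : dot u N = 0 by rewrite uE !dotE NN mulr1 subrr.
  have uv : dot u v = 0.
    apply: (orth 0%N s phi st mphi); split=> //.
    by rewrite uE !dotE dotC xv [dot N _]dotC xN mulr0 subr0.
  have /dot_eq0 : dot u u = 0 by rewrite [in X in dot _ X]uE !dotE uv uN mulr0 subr0.
  by move/eqP; rewrite uE subr_eq0 => /eqP ->; rewrite !coordE scaler0.
have B0 : axial B = 0.
  by apply: flat; rewrite lexx /= ltW//; have [[]] := traj.2 0%N.
split=> //.
(* This [d] stays within the first segment and in (0, pi / 2], so sin d > 0; after time [d] the
   axial velocity is - sin d times the axial part of [A]. *)
have p0 := @pi_gt0 R; pose d := Num.min (pi / 2) (t 1%N - t 0%N).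
have t01 : t 0%N < t 1%N by have [[]] := traj.2 0%N.
have d0 : 0 < d by rewrite lt_min subr_gt0 t01 divr_gt0.
have d1 : d <= t 1%N - t 0%N by rewrite ge_min lexx orbT.
have d2 : d <= pi / 2 by rewrite ge_min lexx.
have sd : 0 < sin d by apply: sin_gt0_pi; rewrite d0 /=; lra.
have /flat : t 0%N <= d + t 0%N <= t 1%N by apply/andP; split; lra.
rewrite gE derive1_great_circle !coordE addrK B0 scaler0 add0r => /eqP.
by rewrite scaler_eq0 gt_eqF//= oppr_eq0 => /eqP.
Qed.

End Periods.

(** * The equatorial orbit and the parity of periods *)

Section Equator.
Variables (R : realType) (n : nat) (theta : R).
Hypothesis theta_bd : 0 < theta < 2 * pi.

Lemma meridian_equator s : meridian s (@equator R n s).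
Proof.
apply/meridianP; rewrite dot_coord !coordE dot0l add0r -!expr2 cos2Dsin2.
by split=> //; exists 1; rewrite ?mul1r.
Qed.

Lemma equator_neq0 s : (xc (@equator R n s) != 0) || (yc (@equator R n s) != 0).
Proof.
rewrite !coordE -negb_and; apply/negP => /andP[/eqP c0 /eqP s0].
by have := cos2Dsin2 s; rewrite c0 s0 expr0n addr0 => /esym/eqP; rewrite oner_eq0.
Qed.

Lemma equator_great_circle t :
  (fun s => @equator R n (s - t)) = great_circle (pt 0 1 0) (pt 0 0 1) t.
Proof.
apply/funext => s; apply: coord_inj; rewrite !coordE ?scaler0 ?addr0//; ring.
Qed.

(** Unit speed leaves two orientations of the equator; the negative one would leave the lune
    immediately. *)
Lemma flat_equator t g : billiard_trajectory theta t g ->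
  axial (g 0%N (t 0%N)) = 0 /\ axial (derive1 (g 0%N) (t 0%N)) = 0 <->
  g 0%N = (fun s => @equator R n (s - t 0%N)).
Proof.
move=> traj; split=> [[A0 B0]|->]; last first.
  by rewrite equator_great_circle derive1_great_circle !coordE oppr0 !scaler0 addr0.
have [AE BE] := flat_start traj A0 B0.
have [_ bb _ gE] := trajectory_start traj.
have [[_ _ int _] _] := traj.
set w := wedge _ _ in BE; clearbody w; rewrite AE BE in bb gE.
rewrite gE equator_great_circle; congr (great_circle _ (pt _ _ _) _).
move: bb; rewrite dot_coord !coordE dot0l mul0r !add0r -expr2 => /eqP.
rewrite sqrf_eq1 => /predU1P[//|/eqP wN]; exfalso.
have /andP[t0 t2] := theta_bd.
(* Before this time the angle t 0 - s is less than 2 pi away from every [alpha] in [0, theta], so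
   [meridian_inj] identifies it with [alpha], although it is negative. *)
have t2' : t 0%N < t 0%N + (2 * pi - theta) by rewrite ltrDl subr_gt0.
have [s [[/= ts st] [[alpha /= /andP[a0 a1] ma] _]]] :=
  filter_ex (filterI (filterI (nbhs_right_gt (t 0%N)) (nbhs_right_lt t2')) int).
have gs : g 0%N s = @equator R n (t 0%N - s).
  rewrite gE wN; apply: coord_inj; rewrite !coordE.
  - by rewrite !scaler0 addr0.
  - by rewrite -[t 0%N - s]opprB cosN; ring.
  - by rewrite -[t 0%N - s]opprB sinN; ring.
have aE : alpha = t 0%N - s.
  rewrite gs in ma; apply: meridian_inj (equator_neq0 _) ma (meridian_equator _).
  by rewrite ger0_norm; lra.
by move: a0; rewrite aE subr_ge0 leNgt ts.
Qed.

(* Angular coordinate at time s of the i-th geodesic of the equatorial orbit. *)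
Definition angle (i : nat) (s : R) : R :=
  if odd i then i.+1%:R * theta - s else s - i%:R * theta.

Lemma reflection_equator phi s :
  reflection phi (@equator R n s) = equator n (phi *+ 2 - s).
Proof.
apply: coord_inj; rewrite ?axial_reflection ?xc_reflection ?yc_reflection !coordE//.
  by rewrite cosB.
by rewrite sinB.
Qed.

Lemma fold_equator i s : fold theta i (@equator R n s) = equator n (angle i s).
Proof.
elim: i => [|i IHi]; first by rewrite /angle /= mul0r subr0.
rewrite /= IHi reflection_equator /angle /wall /= -!natr1; congr equator.
by case: odd; rewrite /= mulr2n; ring.
Qed.

(** The folded angle moves at unit speed from 0 to [theta] on even segments and back on odd ones, so
    collisions occur at the multiples of [theta]. *)
Lemma equator_trajectory :
  billiard_trajectory theta (fun i => i%:R * theta) (fun i s => fold theta i (@equator R n s)).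
Proof.
have /andP[t0 t2] := theta_bd.
have gcE i : (fun s => fold theta i (@equator R n s)) =
    great_circle (fold theta i (pt 0 1 0)) (fold theta i (pt 0 0 1)) 0.
  rewrite -fold_great_circle; apply/funext => s; congr (fold _ _ _).
  by rewrite -equator_great_circle subr0.
have geo i : unit_speed_geodesic (fun s => fold theta i (@equator R n s)).
  rewrite gcE; apply: unit_speed_geodesic_great_circle;
    rewrite dot_fold dot_coord !coordE dot0l; ring.
have hit i : meridian (wall theta i.+1) (fold theta i (@equator R n (i.+1%:R * theta))).
  rewrite fold_equator; have -> : angle i (i.+1%:R * theta) = wall theta i.+1.
    by rewrite /angle /wall /= -natr1; case: odd => /=; ring.
  exact: meridian_equator.
have nhit s : 0 < s < theta -> ~ @lune_boundary R n theta (equator n s).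
  move=> /andP[s0 s1] [m|m].
    have : 0 = s; last by lra.
    apply: meridian_inj (equator_neq0 s) m (meridian_equator s).
    by rewrite sub0r normrN gtr0_norm//; lra.
  have : theta = s; last by lra.
  apply: meridian_inj (equator_neq0 s) m (meridian_equator s).
  by rewrite gtr0_norm; lra.
split.
  rewrite mul0r; split; first exact: (geo 0%N).
  - exact: meridian_equator.
  - near=> s; have s0 : 0 < s by near: s; exact: nbhs_right_gt.
    have s1 : s < theta by near: s; exact: nbhs_right_lt.
    split; last by apply: nhit; rewrite s0.
    by exists s => /=; [rewrite !ltW|exact: meridian_equator].
  - by move=> s /polar_sphereE[_ x0 y0]; have := equator_neq0 s; rewrite x0 y0 eqxx.
move=> i; split.
  split.
  - by rewrite ltr_pM2r// ltr_nat.
  - by rewrite (lune_boundary_wall n theta i); right.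
  - move=> s /andP[is_ si]; rewrite fold_equator; apply: nhit.
    move: is_ si; rewrite /angle -natr1 => ? ?.
    by case: odd; apply/andP; split; lra.
split=> //; first exact: (reflection_fix (hit i)).
exists (wall theta i.+1); split=> //; first by rewrite /wall; case: odd; [right|left].
rewrite [in LHS]gcE [in RHS]gcE !derive1_great_circle /great_circle /=.
by rewrite reflectionD !reflectionZ -[- fold _ _ _]scaleN1r reflectionZ scaleN1r.
Unshelve. all: by end_near. Qed.

Lemma period_even t g q : billiard_trajectory theta t g ->
  @has_period R n theta t g q -> exists2 j, (0 < j)%N & q = j.*2.
Proof.
move=> traj per; have [q0 _ _] := per; have [eq _ _] := period_closes theta_bd traj per.
exists q./2; last by rewrite even_halfK.
by rewrite -double_gt0 even_halfK.
Qed.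

Lemma single_orthogonal_orbit_lune : single_orthogonal_orbit n theta.
Proof.
split.
  exists (fun i => i%:R * theta), (fun i s => fold theta i (@equator R n s)).
  by split; rewrite ?mul0r//; exact: equator_trajectory.
move=> t g traj; split.
  by rewrite (orthogonal_flat theta_bd traj) (flat_equator traj).
move=> /(orthogonal_flat theta_bd traj)[A0 B0]; split; first exact: flat_period.
by move=> k /(period_even traj)[j j0 ->]; rewrite -[2%N]/(1.*2) leq_double.
Qed.

(** By [orthogonal_flat], failing orthogonality means a nonzero axial part in the initial position
    or velocity, as [period_commensurable] requires. *)
Lemma nonorthogonal_period t g q : billiard_trajectory theta t g ->
  ~ orthogonal_to_meridians t g -> @has_period R n theta t g q ->
  exists2 j, (0 < j)%N & q = j.*2 /\ exists k : int, j%:R * theta = k%:~R * pi.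
Proof.
move=> traj north per; have [j j0 qE] := period_even traj per.
exists j => //; split=> //; rewrite -[j]doubleK -qE.
apply: (period_commensurable theta_bd traj per).
have [A0|] := eqVneq (axial (g 0%N (t 0%N))) 0; last by move/eqP; left.
by right => B0; apply: north; apply/(orthogonal_flat theta_bd traj).
Qed.

End Equator.

(** * Rational and irrational opening angles *)

Theorem theorem1 (R : realType) (n : nat) (theta : R)
    (hn : (2 <= n)%N) (htheta : 0 < theta < 2 * pi) :
  ((exists r : rat, theta = ratr r * pi) ->
     (forall (t : nat -> R) (g : nat -> R -> ambient R n),
        billiard_trajectory theta t g -> periodic_trajectory theta t g) /\
     (forall m p : nat, (0 < m)%N -> (0 < p)%N -> coprime m p ->
        theta = m%:R * pi / p%:R ->
        (forall (t : nat -> R) (g : nat -> R -> ambient R n),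
           billiard_trajectory theta t g -> ~ orthogonal_to_meridians t g ->
           has_minimal_period theta t g (2 * p)) /\
        single_orthogonal_orbit n theta)) /\
  ((~ exists r : rat, theta = ratr r * pi) ->
     (forall (t : nat -> R) (g : nat -> R -> ambient R n),
        billiard_trajectory theta t g -> ~ orthogonal_to_meridians t g ->
        ~ periodic_trajectory theta t g) /\
     single_orthogonal_orbit n theta).
Proof.
have single := single_orthogonal_orbit_lune n htheta.
split=> [[r rE]|irr]; split.
(* Multiplying theta = r pi by the denominator of [r] gives the integer relation; the resulting
   period need not be minimal. *)
- move=> t g traj; exists `|denq r|%N.*2.
  apply: (@commensurable_period _ _ _ htheta _ _ traj _ (numq r)).
    by rewrite absz_gt0 denq_eq0.
  rewrite rE /ratr natr_absz gtr0_norm ?denq_gt0// mulrA mulrCA mulfV ?mulr1//.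
  by rewrite intr_eq0 denq_eq0.
- move=> m p m0 p0 mp thetaE; split=> // t g traj north; split.
    rewrite mul2n; apply: (@commensurable_period _ _ _ htheta _ _ traj _ m) => //.
    by rewrite thetaE mulrC divfK// pnatr_eq0 -lt0n.
  move=> q /(nonorthogonal_period htheta traj north)[j j0 [-> [k jk]]].
  (* The relation j theta = k pi becomes j m = k p; since [p] is coprime to [m], it divides [j], so
     p <= j. *)
  rewrite mul2n leq_double dvdn_leq// -(Gauss_dvdr j (_ : coprime p m)) 1?coprime_sym//.
  have pi0 := @pi_gt0 R.
  have /eqP : (j * m)%:R = (k * p%:Z)%:~R :> R.
    have p0' : p%:R != 0 :> R by rewrite pnatr_eq0 -lt0n.
    apply: (mulIf (lt0r_neq0 pi0)).
    by rewrite natrM intrM -pmulrn [in RHS]mulrAC -jk thetaE; field.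
  rewrite -[_%:R]/((j * m)%:Z%:~R) eqr_int => /eqP jm.
  have := congr1 absz jm; rewrite abszM /= mulnC => ->.
  exact: dvdn_mull.
- move=> t g traj north [q /(nonorthogonal_period htheta traj north)[j j0 [_ [k jk]]]].
  (* A period would exhibit theta as (k / j) pi. *)
  apply: irr; exists (k%:~R / j%:R).
  have j0' : j%:R != 0 :> R by rewrite pnatr_eq0 -lt0n.
  apply: (mulfI j0'); rewrite jk fmorph_div/= ratr_int ratr_nat; field.
  exact: j0'.
- exact: single.
Qed.
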